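(* Let $X,Y$ be real Hausdorff locally convex topological vector spaces, let $\varphi:X\times Y\to\overline{\mathbb R}$ be a proper convex function and $G:X\rightrightarrows Y$ a convex set-valued map. Let $\mu(x)=\inf\{\varphi(x,y)\mid y\in G(x)\}$ for $x\in X$. Then for any $\bar x\in X$ with $\mu(\bar x)\in\mathbb R$, and for any $\bar y\in G(\bar x)$, one has $A\subset B$ and $A^\infty\subset B^\infty$, where $$A=\overline{\bigcup_{(x^*,y^* )\in\partial\varphi(\bar x,\bar y)}\{x^*+D^*G(\bar x,\bar y)(y^* )\}},\qquad B=\mathrm{pr}_{X^*}\Big[\overline{\partial\varphi(\bar x,\bar y)+N((\bar x,\bar y);\mathrm{gph}\,G)}\cap(X^*\times\{0\})\Big],$$ $$A^\infty=\overline{\bigcup_{(x^*,y^* )\in\partial^\infty\varphi(\bar x,\bar y)}\{x^*+D^*G(\bar x,\bar y)(y^* )\}},\qquad B^\infty=\mathrm{pr}_{X^*}\Big[\overline{\partial^\infty\varphi(\bar x,\bar y)+N((\bar x,\bar y);\mathrm{gph}\,G)}\cap(X^*\times\{0\})\Big].$$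
   Context: $\overline{\mathbb R}=\mathbb R\cup\{\pm\infty\}$, $\inf\emptyset=+\infty$. Dual spaces $X^*$, $Y^*$ carry the weak$^*$ topology, $(X\times Y)^*$ is identified with $X^*\times Y^*$, and an overline over a subset of a dual space is the weak$^*$ closure. $\mathrm{pr}_{X^*}:X^*\times Y^*\to X^*$, $(x^*,y^* )\mapsto x^*$. A function $f:Z\to\overline{\mathbb R}$ is proper if $\mathrm{dom}\,f=\{z\mid f(z)<+\infty\}\ne\emptyset$ and $f(z)\neq-\infty$ for all $z$; $\mathrm{epi}\,f=\{(z,\lambda)\in Z\times\mathbb R\mid f(z)\le\lambda\}$; $f$ is convex if $\mathrm{epi}\,f$ is convex. A set-valued map $G$ is convex if $\mathrm{gph}\,G=\{(x,y)\mid y\in G(x)\}$ is convex. Normal cone to a convex set $C$: $N(\bar z;C)=\{z^*\mid\langle z^*,z-\bar z\rangle\le0\ \forall z\in C\}$ if $\bar z\in C$, and $\emptyset$ otherwise. For convex $f$ with $f(\bar z)\in\mathbb R$: $\partial f(\bar z)=\{z^*\mid\langle z^*,z-\bar z\rangle\le f(z)-f(\bar z)\ \forall z\in Z\}$ and $\partial^\infty f(\bar z)=\{z^*\mid(z^*,0)\in N((\bar z,f(\bar z));\mathrm{epi}\,f)\}$; both are $\emptyset$ if $f(\bar z)\notin\mathbb R$. Coderivative of a convex set-valued map $G$ at $(\bar x,\bar y)\in\mathrm{gph}\,G$: $D^*G(\bar x,\bar y)(y^* )=\{x^*\in X^*\mid(x^*,-y^* )\in N((\bar x,\bar y);\mathrm{gph}\,G)\}$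 for $y^*\in Y^*$. *)

(* Defs.v *)
From HB Require Import structures.
From mathcomp Require Import all_boot all_order all_algebra.
From mathcomp Require Import all_classical all_reals all_analysis.

Set Implicit Arguments.
Unset Strict Implicit.
Unset Printing Implicit Defensive.
Import Order.TTheory GRing.Theory Num.Theory.
Import numFieldTopology.Exports.
Local Open Scope classical_set_scope.
Local Open Scope ring_scope.

Section dual.
Context {R : realType} (Z : tvsType R).

Definition is_dual : {pred Z -> R^o} :=
  mem [set f : Z -> R^o | linear f /\ continuous f].

Lemma is_dual_submod : submod_closed is_dual.
Proof.
split.
  rewrite inE/=; split; last by move=> z; exact: cvg_cst.
  by move=> a u v /=; rewrite scaler0 addr0.
move=> a f g; rewrite !inE/= => -[lf cf] [lg cg]; split.
  move=> b u v.
    rewrite -[LHS]/(a *: f (b *: u + v) + g (b *: u + v)) lf lg.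
    rewrite -[RHS]/(b *: (a *: f u + g u) + (a *: f v + g v)).
  by rewrite !scalerDr addrACA !scalerA [a * b]mulrC.
move=> z.
have caf : (fun z => a *: f z : R^o) @ z --> (a *: f z : R^o).
  apply: (@continuous_comp Z (R^o * R^o)%type R^o (fun z => (a : R^o, f z))
    (fun x => x.1 *: x.2)); last exact: scale_continuous.
  exact: (cvg_pair (cvg_cst (a : R^o)) (cf z)).
apply: (@continuous_comp Z (R^o * R^o)%type R^o (fun z => (a *: f z, g z))
  (fun x => x.1 + x.2)); last exact: add_continuous.
exact: (cvg_pair caf (cg z)).
Qed.

HB.instance Definition _ :=
  GRing.isSubmodClosed.Build R (Z -> R^o) is_dual is_dual_submod.

Record dual := Dual { dual_val :> Z -> R^o ; _ : dual_val \in is_dual }.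

HB.instance Definition _ := [isSub for dual_val].
HB.instance Definition _ := [Choice of dual by <:].
HB.instance Definition _ := [SubChoice_isSubLmodule of dual by <:].

(* The weak* topology: the topology of pointwise convergence. *)
HB.instance Definition _ := Topological.copy dual
  (initial_topology (dual_val : dual -> {ptws Z -> R^o})).

Lemma dualP (f : dual) : linear f /\ continuous f.
Proof. by case: f => f /=; rewrite inE. Qed.

End dual.

Arguments is_dual {R} Z.

Section identification.
Context {R : realType} {X Y : tvsType R}.

Lemma dual_pair_subproof (xs : dual X) (ys : dual Y) :
  (fun z : X * Y => xs z.1 + ys z.2) \in is_dual (X * Y)%type.
Proof.
have [lx cx] := dualP xs; have [ly cy] := dualP ys.
rewrite inE/=; split.
  by move=> a [u1 u2] [v1 v2] /=; rewrite lx ly scalerDr addrACA.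
move=> z.
have cx1 : (fun z : X * Y => xs z.1) @ z --> (xs z.1 : R^o).
  by apply: (@continuous_comp (X * Y)%type X R^o fst xs);
    [exact: cvg_fst|exact: cx].
have cy2 : (fun z : X * Y => ys z.2) @ z --> (ys z.2 : R^o).
  by apply: (@continuous_comp (X * Y)%type Y R^o snd ys);
    [exact: cvg_snd|exact: cy].
apply: (@continuous_comp (X * Y)%type (R^o * R^o)%type R^o
  (fun z => (xs z.1, ys z.2)) (fun x => x.1 + x.2)); last exact: add_continuous.
exact: (cvg_pair cx1 cy2).
Qed.

(* The identification of X^* x Y^* with (X x Y)^*; its inverse is given by
   dual_pr1 and dual_pr2 below. *)
Definition dual_pair (xs : dual X) (ys : dual Y) : dual (X * Y)%type :=
  Dual (dual_pair_subproof xs ys).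

Lemma dual_pr1_subproof (zs : dual (X * Y)%type) :
  (fun x : X => zs (x, 0)) \in is_dual X.
Proof.
have [lz cz] := dualP zs; rewrite inE/=; split.
  by move=> a u v; rewrite -lz; congr (zs _); congr pair; rewrite /= scaler0 addr0.
move=> x; apply: (@continuous_comp X (X * Y)%type R^o (fun x => (x, 0)) zs);
  last exact: cz.
move=> U [[A B] /= [Ax B0] ABU]; apply: filterS Ax => u Au; apply: ABU.
by split=> //=; exact: nbhs_singleton.
Qed.

Lemma dual_pr2_subproof (zs : dual (X * Y)%type) :
  (fun y : Y => zs (0, y)) \in is_dual Y.
Proof.
have [lz cz] := dualP zs; rewrite inE/=; split.
  by move=> a u v; rewrite -lz; congr (zs _); congr pair; rewrite /= scaler0 addr0.
move=> y; apply: (@continuous_comp Y (X * Y)%type R^o (fun y => (0, y)) zs);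
  last exact: cz.
move=> U [[A B] /= [A0 By] ABU]; apply: filterS By => u Bu; apply: ABU.
by split=> //=; exact: nbhs_singleton.
Qed.

Definition dual_pr1 (zs : dual (X * Y)%type) : dual X :=
  Dual (dual_pr1_subproof zs).

Definition dual_pr2 (zs : dual (X * Y)%type) : dual Y :=
  Dual (dual_pr2_subproof zs).

Lemma dual_pairK (zs : dual (X * Y)%type) :
  dual_pair (dual_pr1 zs) (dual_pr2 zs) = zs.
Proof.
apply/val_inj/funext => -[x y] /=; have [lz _] := dualP zs.
have := lz 1 (x, 0) (0, y); rewrite scale1r => /esym.
rewrite [1 *: _]scale1r => ->.
by congr (zs _); congr pair; rewrite /= ?addr0 ?add0r.
Qed.

Lemma dual_pair_pr1 (xs : dual X) (ys : dual Y) :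
  dual_pr1 (dual_pair xs ys) = xs.
Proof.
apply/val_inj/funext => x /=; have [ly _] := dualP ys.
have := ly (-1) 0 0; rewrite scaler0 addr0 => ->.
by rewrite [-1 *: _]scaleN1r addNr addr0.
Qed.

Lemma dual_pair_pr2 (xs : dual X) (ys : dual Y) :
  dual_pr2 (dual_pair xs ys) = ys.
Proof.
apply/val_inj/funext => y /=; have [lx _] := dualP xs.
have := lx (-1) 0 0; rewrite scaler0 addr0 => ->.
by rewrite [-1 *: _]scaleN1r addNr add0r.
Qed.

End identification.

Section convex_analysis.
Context {R : realType}.

Section one_space.
Context {Z : tvsType R}.
Implicit Types (f : Z -> \bar R) (C : set Z) (z : Z).

Definition edom f : set Z := [set z | (f z < +oo)%E].

Definition proper_fun f : Prop := edom f !=set0 /\ forall z, f z <> -oo%E.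

Definition epi f : set (Z * R^o) := [set p | (f p.1 <= p.2%:E)%E].

Definition convex_fun f : Prop := convex_set (epi f).

End one_space.

Definition normal_cone {Z : tvsType R} (z : Z) (C : set Z) : set (dual Z) :=
  [set zs | C z /\ forall w, C w -> zs (w - z) <= 0].

Definition dual_add {Z : tvsType R} (A B : set (dual Z)) : set (dual Z) :=
  [set a + b | a in A & b in B].

(* As f z is finite, f w - f z is never of the form oo - oo. *)
Definition subdiff {Z : tvsType R} (f : Z -> \bar R) (z : Z) : set (dual Z) :=
  [set zs | f z \is a fin_num /\
            forall w, ((zs (w - z))%:E <= f w - f z)%E].

Definition singular_subdiff {Z : tvsType R} (f : Z -> \bar R) (z : Z) :
    set (dual Z) :=
  [set zs | f z \is a fin_num /\
            normal_cone (z, fine (f z) : R^o) (epi f) (dual_pair zs 0)].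

Section two_spaces.
Context {X Y : tvsType R}.
Implicit Types (G : X -> set Y) (phi : X * Y -> \bar R).

Definition gph G : set (X * Y) := [set p | G p.1 p.2].

Definition convex_map G : Prop := convex_set (gph G).

Definition coderivative G (x : X) (y : Y) (ys : dual Y) : set (dual X) :=
  [set xs | normal_cone (x, y) (gph G) (dual_pair xs (- ys))].

Definition optimal_value phi G (x : X) : \bar R :=
  ereal_inf [set phi (x, y) | y in G x].

End two_spaces.
End convex_analysis.

(* Main.v *)
Require Import Defs.
From mathcomp Require Import all_boot all_order all_algebra.
From mathcomp Require Import all_classical all_reals all_analysis.
Local Open Scope classical_set_scope.
Local Open Scope ring_scope.

(* Every generator [x^* + u^*] of the left-hand set yields
   [(x^* + u^*, 0) = (x^*, y^* ) + (u^*, - y^* )], which lies in the sum of the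
   (singular) subdifferential and the normal cone; since [x^* |-> (x^*, 0)] is
   weak* continuous, this passes to the closures. *)

(** The weak* topology is initial for the inclusion of [dual Z] into the functions with pointwise
    convergence, so evaluation is this inclusion followed by a coordinate projection. *)
Lemma dual_eval_continuous (R : realType) (Z : tvsType R) (z : Z) :
  continuous (fun f : dual Z => f z : R^o).
Proof.
move=> f; apply: (@continuous_comp (dual Z) {ptws Z -> R^o} R^o
  (dual_val (Z := Z)) (@^~ z)).
  exact: initial_continuous.
exact: (@proj_continuous Z (fun=> R^o) z).
Qed.

(** Universal property of the initial topology: weak* continuity is tested one evaluation at a
    time. *)
Lemma dual_continuousP (R : realType) (T : topologicalType) (Z : tvsType R)
    (F : T -> dual Z) :
  (forall z, continuous (fun t => F t z : R^o)) -> continuous F.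
Proof.
move=> cF; apply: (@continuous_comp_initial (dual Z) T {ptws Z -> R^o}
  (dual_val (Z := Z)) F) => t.
by apply/pointwise_cvgP => z; exact: cF.
Qed.

Lemma dual_pair0_continuous (R : realType) (X Y : tvsType R) :
  continuous (fun xs : dual X => dual_pair xs (0 : dual Y)).
Proof.
apply: dual_continuousP => -[u v] xs /=.
(* Evaluating the pair at [(u, v)] only sees [xs u], since the second functional is zero. *)
have -> : (fun xs : dual X => xs u + 0) = (fun xs : dual X => xs u : R^o).
  by apply/funext => f; rewrite GRing.addr0.
exact: dual_eval_continuous.
Qed.

Lemma image_closure_subset (T U : topologicalType) (f : T -> U) (A : set T) :
  continuous f -> f @` closure A `<=` closure (f @` A).
Proof.
move=> cf _ [t clAt <-] B /cf /clAt [s [As Bs]].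
by exists (f s); split=> //; exists s.
Qed.

Lemma dual_pairD (R : realType) (X Y : tvsType R) (xs us : dual X)
    (ys vs : dual Y) :
  dual_pair xs ys + dual_pair us vs = dual_pair (xs + us) (ys + vs).
Proof. by apply/val_inj/funext => -[u v]; exact: GRing.addrACA. Qed.

(** The set [D] is arbitrary, so that [subdiff] and [singular_subdiff] are both instances. *)
Lemma closure_coderivative_subset (R : realType) (X Y : tvsType R)
    (D : set (dual (X * Y)%type)) (G : X -> set Y) (x : X) (y : Y) :
  closure (\bigcup_(p in [set p : dual X * dual Y | D (dual_pair p.1 p.2)])
             [set p.1 + us | us in coderivative G x y p.2])
  `<=`
  dual_pr1 @` (closure (dual_add D (normal_cone (x, y) (gph G)))
               `&` [set dual_pair xs 0 | xs in [set: dual X]]).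
Proof.
move=> xs clxs; exists (dual_pair xs 0); last exact: dual_pair_pr1.
split; last by exists xs.
(* The inclusion is proved before taking closures; monotonicity of the closure then transports
   it. *)
have /closureS : [set dual_pair ws 0 | ws in \bigcup_(p in
      [set p : dual X * dual Y | D (dual_pair p.1 p.2)])
      [set p.1 + us | us in coderivative G x y p.2]] `<=`
    dual_add D (normal_cone (x, y) (gph G)).
  move=> _ [_ [[ps qs] /= Dpq [us Nus <-]] <-].
  (* By definition of the coderivative, [Nus] places [(us, - qs)] in the normal cone. *)
  exists (dual_pair ps qs) => //; exists (dual_pair us (- qs)) => //.
  by rewrite dual_pairD GRing.subrr.
apply; apply: image_closure_subset; first exact: dual_pair0_continuous.
by exists xs.
Qed.

Theorem theorem3p1 (R : realType) (X Y : tvsType R)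
  (hausX : hausdorff_space X) (hausY : hausdorff_space Y)
  (phi : X * Y -> \bar R) (G : X -> set Y)
  (phi_proper : proper_fun phi) (phi_convex : convex_fun phi)
  (G_convex : convex_map G)
  (x : X) (mu_fin : optimal_value phi G x \is a fin_num)
  (y : Y) (Gxy : G x y) :
  closure (\bigcup_(p in [set p : dual X * dual Y |
                          subdiff phi (x, y) (dual_pair p.1 p.2)])
             [set p.1 + us | us in coderivative G x y p.2])
  `<=`
  dual_pr1 @` (closure (dual_add (subdiff phi (x, y))
                                 (normal_cone (x, y) (gph G)))
               `&` [set dual_pair xs 0 | xs in [set: dual X]])
  /\
  closure (\bigcup_(p in [set p : dual X * dual Y |
                          singular_subdiff phi (x, y) (dual_pair p.1 p.2)])
             [set p.1 + us | us in coderivative G x y p.2])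
  `<=`
  dual_pr1 @` (closure (dual_add (singular_subdiff phi (x, y))
                                 (normal_cone (x, y) (gph G)))
               `&` [set dual_pair xs 0 | xs in [set: dual X]]).
Proof. by split; exact: closure_coderivative_subset. Qed.
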